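(* Let $r=\frac{\alpha}{\beta}>0$ be a rational number, with $\alpha,\beta$ coprime positive integers. Then $r$ has a continued fraction expansion $$\frac{\alpha}{\beta}=[1,2e_2,e_3,2e_4,\ldots,e_{2n-1},2e_{2n}],\qquad e_i=\pm1,$$ if and only if $\beta$ is even. Furthermore, we can suppose that there are no three consecutive sign changes. In this case the continued fraction is unique, and (with $e_1=1$) $\alpha>\beta$ if and only if $e_1=e_2=1$.
   Context: For integers $a_1,\dots,a_n$, $[a_1,\ldots,a_n]$ denotes the continued fraction $a_1+\cfrac{1}{a_2+\cfrac{1}{\cdots+\cfrac{1}{a_n}}}$. A sign change at position $i$ in $[a_1,\dots,a_n]$ means $a_ia_{i+1}<0$. ''No three consecutive sign changes'' means that there is no $i$ with $a_ia_{i+1}<0$, $a_{i+1}a_{i+2}<0$ and $a_{i+2}a_{i+3}<0$. *)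

(* Defs.v *)
From mathcomp Require Import all_boot all_order all_algebra.

Set Implicit Arguments.
Unset Strict Implicit.
Unset Printing Implicit Defensive.

Import Order.TTheory GRing.Theory Num.Theory.
Local Open Scope ring_scope.

(* [cfrac a] is the value of [a_1, ..., a_n] as an ordinary nested fraction: it
   is [None] (undefined) as soon as one of the nested denominators vanishes.
   The convention 1/0 = oo would break uniqueness: [1,2,1,2,-1,2] would equal
   [1,2]. *)
Fixpoint cfrac (a : seq int) : option rat :=
  match a with
  | [::] => None
  | x :: s =>
    if s is [::] then Some x%:~R
    else if cfrac s is Some y then
      if y == 0 then None else Some (x%:~R + y^-1)
    else None
  end.

(* Sequences are indexed from 0, so the odd indices are the positions
   2, 4, 6, ... that carry the factor 2. *)
Definition terms12 (e : seq int) : seq int :=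
  mkseq (fun i => if odd i then 2 * e`_i else e`_i) (size e).

Definition expansion12 (r : rat) (e : seq int) : Prop :=
  [/\ exists2 n : nat, (0 < n)%N & size e = (2 * n)%N,
      forall x : int, x \in e -> x = 1 \/ x = -1,
      e`_0 = 1
    & cfrac (terms12 e) = Some r].

(* Out of range a`_i = 0, so a sign change only occurs inside the sequence. *)
Definition sign_change (a : seq int) (i : nat) : bool := a`_i * a`_i.+1 < 0.

Definition no_three_consecutive_sign_changes (a : seq int) : Prop :=
  ~ exists i : nat,
      [/\ sign_change a i, sign_change a i.+1 & sign_change a i.+2].

(* Main.v *)
(** An expansion [1, 2 e_2, ...] without three consecutive sign changes reveals
    its first terms by the position of its value among 1/2, 1, 3/2 and 2, and
    stripping them leaves, up to sign, a value of the same kind.  This defines a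
    deterministic algorithm on positive rationals, whence uniqueness.  On odd/even
    fractions it never increases the denominator, and decreases the numerator when
    it keeps the denominator, so it terminates; parity rules out the values 1 and 2,
    and the algorithm stops at 1/2 or 3/2.  Conversely every value of an expansion
    is odd/even, whatever its sign changes. *)
Require Import Defs.
From mathcomp Require Import all_boot all_order all_algebra.
From mathcomp Require Import zify ring lra.

Set Implicit Arguments.
Unset Strict Implicit.
Unset Printing Implicit Defensive.

Import Order.TTheory GRing.Theory Num.Theory.
Local Open Scope ring_scope.

Lemma terms12_cons2 (x y : int) (e : seq int) :
  terms12 [:: x, y & e] = [:: x, 2 * y & terms12 e].
Proof.
rewrite /terms12 /mkseq /= -[2%N]/(2 + 0)%N iotaDl -map_comp.
by congr [:: _, _ & _]; apply: eq_map => i /=; rewrite negbK.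
Qed.

Lemma terms12_opp (e : seq int) : terms12 (map -%R e) = map -%R (terms12 e).
Proof.
rewrite /terms12 /mkseq size_map -map_comp; apply/eq_in_map => i.
rewrite mem_iota => /= lt_i; rewrite (nth_map 0) //.
by case: ifP; rewrite // mulrN.
Qed.

Lemma cfrac_cons2 (x y : int) (a : seq int) (r : rat) :
  cfrac [:: x, y & a] = Some r <->
  exists2 t, cfrac (y :: a) = Some t & t != 0 /\ r = x%:~R + t^-1.
Proof.
have -> : cfrac [:: x, y & a] = if cfrac (y :: a) is Some t then
  if t == 0 then None else Some (x%:~R + t^-1) else None by [].
case: (cfrac (y :: a)) => [t|]; last by split=> // -[].
case: (eqVneq t 0) => [->|t0]; first by split=> // -[_ [<-]] [/eqP].
by split=> [[<-]|[_ [<-] [_ ->]]]; first by exists t.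
Qed.

Lemma cfrac_opp (a : seq int) (r : rat) :
  cfrac a = Some r -> cfrac (map -%R a) = Some (- r).
Proof.
elim: a r => [//|x [|y a] IH] r; first by move=> [<-] /=; rewrite rmorphN.
case/cfrac_cons2=> t /IH at_ [t0 ->]; apply/cfrac_cons2.
by exists (- t); rewrite // oppr_eq0 rmorphN invrN opprD.
Qed.

Lemma sign_change_terms12 (e : seq int) (i : nat) :
  sign_change (terms12 e) i = sign_change e i.
Proof.
have nthE j : (terms12 e)`_j = (if odd j then 2 else 1) * e`_j.
  have [lt_j|le_j] := ltnP j (size e).
    by rewrite nth_mkseq //; case: ifP; rewrite // mul1r.
  by rewrite !nth_default ?size_mkseq // mulr0.
rewrite /sign_change !nthE /=; case: (odd i) => /=; lia.
Qed.

Lemma no_three_terms12 (e : seq int) :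
  no_three_consecutive_sign_changes (terms12 e) <->
  no_three_consecutive_sign_changes e.
Proof.
split=> nt [i sc]; apply: nt; exists i; first by rewrite !sign_change_terms12.
by rewrite -!(sign_change_terms12 e).
Qed.

Lemma no_three_opp (e : seq int) :
  no_three_consecutive_sign_changes (map -%R e) <->
  no_three_consecutive_sign_changes e.
Proof.
have scE i : sign_change (map -%R e) i = sign_change e i.
  have nthE j : (map -%R e)`_j = - e`_j.
    have [lt_j|le_j] := ltnP j (size e); first by rewrite (nth_map 0).
    by rewrite !nth_default ?size_map // oppr0.
  by rewrite /sign_change !nthE mulrNN.
by split=> nt [i]; [rewrite -!scE | rewrite !scE]; move=> sc; apply: nt; exists i.
Qed.

Lemma no_three_cons (x : int) (e : seq int) :
  no_three_consecutive_sign_changes (x :: e) <->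
  ~~ [&& x * e`_0 < 0, e`_0 * e`_1 < 0 & e`_1 * e`_2 < 0] /\
  no_three_consecutive_sign_changes e.
Proof.
split=> [nt|[/negP nt0 nt] [[|i] [sc0 sc1 sc2]]].
- split; last by case=> i sc; apply: nt; exists i.+1.
  by apply/negP => /and3P[*]; apply: nt; exists 0%N.
- by apply: nt0; apply/and3P.
- by apply: nt; exists i.
Qed.

Lemma expansion12_2 (r : rat) (y : int) :
  expansion12 r [:: 1; y] <->
  (y = 1 \/ y = -1) /\ r = 1 + (2 * y%:~R)^-1.
Proof.
rewrite /expansion12 -[terms12 _]/[:: 1; 2 * y]; split.
  case=> _ u _ H; have yu : y = 1 \/ y = -1 by apply: u; rewrite !inE eqxx orbT.
  by split=> //; case/cfrac_cons2: H => _ [<-] [_ ->]; rewrite intrM.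
case=> yu ->; split=> //; first by exists 1%N.
  by move=> x; rewrite !inE => /orP[/eqP|/eqP->] //; left.
apply/cfrac_cons2; exists (2 * y)%:~R => //; rewrite intrM.
by case: yu => ->.
Qed.

Lemma cfrac_terms12_cons3 (r : rat) (x y z : int) (e : seq int) :
  cfrac (terms12 [:: x, y, z & e]) = Some r <->
  exists2 t, cfrac (terms12 (z :: e)) = Some t &
    [/\ t != 0, 2 * y%:~R + t^-1 != 0 & r = x%:~R + (2 * y%:~R + t^-1)^-1].
Proof.
rewrite terms12_cons2.
have -> : terms12 (z :: e) = z :: behead (terms12 (z :: e)) by [].
move: (behead _) => a; split.
  case/cfrac_cons2=> u /cfrac_cons2[t at_ [t0 ->]] [u0 ->].
  by exists t => //; rewrite intrM in u0 *.
case=> t at_ [t0 u0 ->]; apply/cfrac_cons2; exists (2 * y%:~R + t^-1) => //.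
by apply/cfrac_cons2; exists t; rewrite // intrM.
Qed.

Lemma unit_int_opp (x : int) : - x = 1 \/ - x = -1 <-> x = 1 \/ x = -1.
Proof. by split=> -[]; lia. Qed.

Lemma expansion12_cons3 (r : rat) (y : int) (e : seq int) : e`_0 = 1 ->
  expansion12 r [:: 1, y & e] <->
  (y = 1 \/ y = -1) /\ exists2 t, expansion12 t e &
    [/\ t != 0, 2 * y%:~R + t^-1 != 0 & r = 1 + (2 * y%:~R + t^-1)^-1].
Proof.
case: e => [//|z e] e0; split.
  case=> -[n n0 sz] u _ /cfrac_terms12_cons3[t et tr].
  split; first by apply: u; rewrite !inE eqxx orbT.
  exists t => //; split=> //; first by exists n.-1; move: sz => /=; lia.
  by move=> x xe; apply: u; rewrite 2!in_cons xe !orbT.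
case=> yu [t [[n n0 sz] u _ et] tr]; split=> //.
- by exists n.+1; rewrite //= mulnS -sz.
- by move=> x; rewrite 2!in_cons => /or3P[/eqP->|/eqP->|] //; [left | apply: u].
- by apply/cfrac_terms12_cons3; exists t.
Qed.

Lemma expansion12_cons3_opp (r : rat) (y : int) (e : seq int) : e`_0 = 1 ->
  expansion12 r [:: 1, y & map -%R e] <->
  (y = 1 \/ y = -1) /\ exists2 t, expansion12 t e &
    [/\ t != 0, 2 * y%:~R - t^-1 != 0 & r = 1 + (2 * y%:~R - t^-1)^-1].
Proof.
case: e => [//|z e] e0; split.
  case=> -[n n0 sz] u _ /cfrac_terms12_cons3[t /cfrac_opp].
  rewrite -terms12_opp -[- z :: _]/(map -%R (z :: e)) -map_comp.
  rewrite (eq_map (@opprK _)) map_id => et [t0 u0 ->].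
  split; first by apply: u; rewrite !inE eqxx orbT.
  exists (- t); last by rewrite oppr_eq0 invrN opprK.
  split=> //; first by exists n.-1; move: sz; rewrite /= size_map; lia.
  by move=> x xe; apply/unit_int_opp/u; rewrite 2!in_cons (map_f _ xe) !orbT.
case=> yu [t [[n n0 sz] u _ et] [t0 u0 ->]]; split=> //.
- by exists n.+1; rewrite //= mulnS -sz size_map.
- move=> x; rewrite 2!in_cons => /or3P[/eqP->|/eqP->|] //; first by left.
  by case/mapP => {}x xe ->; apply/unit_int_opp/u.
- apply/cfrac_terms12_cons3; exists (- t); last by rewrite oppr_eq0 invrN.
  by rewrite -[- z :: _]/(map -%R (z :: e)) terms12_opp; apply: cfrac_opp.
Qed.

(* No sign-change condition is needed: the tail values in the cases
   [greedy_0_half] and [greedy_three_halves_2] exceed 1, so the tail starts with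
   [1, 1]. *)
Inductive greedy (r : rat) : seq int -> Prop :=
| greedy_half : r = 2^-1 -> greedy r [:: 1; -1]
| greedy_three_halves : r = 3 / 2 -> greedy r [:: 1; 1]
| greedy_0_half e :
    0 < r < 2^-1 -> greedy ((1 - r) / (1 - 2 * r)) e -> greedy r [:: 1, -1 & e]
| greedy_half_1 e :
    2^-1 < r < 1 -> greedy ((1 - r) / (2 * r - 1)) e ->
    greedy r [:: 1, -1 & map -%R e]
| greedy_1_three_halves e :
    1 < r < 3 / 2 -> greedy ((r - 1) / (3 - 2 * r)) e -> greedy r [:: 1, 1 & e]
| greedy_three_halves_2 e :
    3 / 2 < r < 2 -> greedy ((r - 1) / (2 * r - 3)) e ->
    greedy r [:: 1, 1 & map -%R e]
| greedy_gt2 e :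
    2 < r -> greedy (r - 2) e -> greedy r [:: 1, 1, -1, 1 & e].

Lemma greedy_gt0 (r : rat) (e : seq int) : greedy r e -> 0 < r.
Proof. by case=> *; lra. Qed.

Lemma greedy_head (r : rat) (e : seq int) :
  greedy r e -> exists s, e = [:: 1, if 1 < r then 1 else -1 & s].
Proof. by case=> *; (case: ifP => ?; last try lra); try lra; eexists. Qed.

Lemma greedy_unique (r : rat) (e e' : seq int) :
  greedy r e -> greedy r e' -> e = e'.
Proof.
move=> re; elim: re e' => {r e} r.
- by move=> ? e' []; intros; done || (exfalso; lra).
- by move=> ? e' []; intros; done || (exfalso; lra).
- by move=> e ? _ IH e' []; intros;
    (congr [:: _, _ & _]; exact: IH) || (exfalso; lra).
- by move=> e ? _ IH e' []; intros;
    (congr [:: _, _ & map _ _]; exact: IH) || (exfalso; lra).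
- by move=> e ? _ IH e' []; intros;
    (congr [:: _, _ & _]; exact: IH) || (exfalso; lra).
- by move=> e ? _ IH e' []; intros;
    (congr [:: _, _ & map _ _]; exact: IH) || (exfalso; lra).
- by move=> e ? _ IH e' []; intros;
    (congr [:: _, _, _, _ & _]; exact: IH) || (exfalso; lra).
Qed.

Lemma greedy_exists (a b : nat) : (0 < b)%N -> odd a -> ~~ odd b ->
  exists e, greedy (a%:R / b%:R) e.
Proof.
have [m] := ubnP b; elim: m a b => // m IHm a b.
have [n] := ubnP a; elim: n a => // n IHn a lt_an lt_bm b0 oa ob.
have bR : (0 : rat) < b%:R by rewrite ltr0n.
have aR : (0 : rat) < a%:R by rewrite ltr0n; lia.
have IH a' b' : (0 < b' < b)%N -> odd a' -> ~~ odd b' ->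
    exists e, greedy (a'%:R / b'%:R) e.
  by case/andP=> b'0 b'b; apply: IHm => //; lia.
have [lt_ab|lt_ba|] := ltngtP a b; last by lia.
- have [lt_2ab|lt_b2a|eq_2ab] := ltngtP (2 * a)%N b.
  + have lt2 := lt_2ab; rewrite -(ltr_nat rat) natrM in lt2.
    have [||| e ge] := IH (b - a)%N (b - 2 * a)%N; try lia.
    exists [:: 1, -1 & e]; apply: greedy_0_half.
      by rewrite ltr_pdivrMr // divr_gt0 //=; lra.
    rewrite !natrB ?natrM in ge; try lia.
    congr (greedy _ e): ge; field; apply/andP; split; lra.
  + have lt2 := lt_b2a; rewrite -(ltr_nat rat) natrM in lt2.
    have lt1 := lt_ab; rewrite -(ltr_nat rat) in lt1.
    have [||| e ge] := IH (b - a)%N (2 * a - b)%N; try lia.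
    exists [:: 1, -1 & map -%R e]; apply: greedy_half_1.
      by rewrite (ltr_pdivrMr _ _ bR) (ltr_pdivlMr _ _ bR); lra.
    rewrite !natrB ?natrM in ge; try lia.
    congr (greedy _ e): ge; field; apply/andP; split; lra.
  + exists [:: 1; -1]; apply: greedy_half.
    by rewrite -eq_2ab natrM; field; lra.
have [lt_a2b|lt_2ba|] := ltngtP a (2 * b)%N; last by lia.
- have lt2 := lt_a2b; rewrite -(ltr_nat rat) natrM in lt2.
  have lt1 := lt_ba; rewrite -(ltr_nat rat) in lt1.
  have [lt_2a3b|lt_3b2a|eq_2a3b] := ltngtP (2 * a)%N (3 * b)%N.
  + have lt3 := lt_2a3b; rewrite -(ltr_nat rat) !natrM in lt3.
    have [||| e ge] := IH (a - b)%N (3 * b - 2 * a)%N; try lia.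
    exists [:: 1, 1 & e]; apply: greedy_1_three_halves.
      by rewrite (ltr_pdivrMr _ _ bR) (ltr_pdivlMr _ _ bR); lra.
    rewrite !natrB ?natrM in ge; try lia.
    congr (greedy _ e): ge; field; apply/andP; split; lra.
  + have lt3 := lt_3b2a; rewrite -(ltr_nat rat) !natrM in lt3.
    have [||| e ge] := IH (a - b)%N (2 * a - 3 * b)%N; try lia.
    exists [:: 1, 1 & map -%R e]; apply: greedy_three_halves_2.
      by rewrite (ltr_pdivrMr _ _ bR) (ltr_pdivlMr _ _ bR); lra.
    rewrite !natrB ?natrM in ge; try lia.
    congr (greedy _ e): ge; field; apply/andP; split; lra.
  + exists [:: 1; 1]; apply: greedy_three_halves.
    have := congr1 (fun k : nat => k%:R : rat) eq_2a3b; rewrite !natrM => eqR.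
    have -> : (a%:R : rat) = 3 / 2 * b%:R by lra.
    by field; lra.
- have lt2 := lt_2ba; rewrite -(ltr_nat rat) natrM in lt2.
  have [||||| e ge] := IHn (a - 2 * b)%N; try lia.
  exists [:: 1, 1, -1, 1 & e]; apply: greedy_gt2.
    by rewrite ltr_pdivlMr.
  rewrite !natrB ?natrM in ge; try lia.
  by congr (greedy _ e): ge; field; lra.
Qed.

Lemma greedy_no_three (r : rat) (e : seq int) :
  greedy r e -> no_three_consecutive_sign_changes e.
Proof.
elim=> {r e} r.
- by move=> _ [[|[|i]] [_]].
- by move=> _ [[|[|i]] [_]].
- move=> e r_lt ge nt; have [s es] := greedy_head ge.
  rewrite ifT in es; last by rewrite ltr_pdivlMr; lra.
  by do 2 (apply/no_three_cons; split; first by rewrite es).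
- move=> e r_lt ge /no_three_opp nt; have [s es] := greedy_head ge.
  by do 2 (apply/no_three_cons; split; first by rewrite es).
- move=> e r_lt ge nt; have [s es] := greedy_head ge.
  by do 2 (apply/no_three_cons; split; first by rewrite es).
- move=> e r_lt ge /no_three_opp nt; have [s es] := greedy_head ge.
  rewrite ifT in es; last by rewrite ltr_pdivlMr; lra.
  by do 2 (apply/no_three_cons; split; first by rewrite es ?andbF).
- move=> e r_lt ge nt; have [s es] := greedy_head ge.
  by do 4 (apply/no_three_cons; split; first by rewrite es).
Qed.

Lemma greedy_expansion12 (r : rat) (e : seq int) : greedy r e -> expansion12 r e.
Proof.
elim=> {r e} r.
- by move=> ->; apply/expansion12_2; split; [right | lra].
- by move=> ->; apply/expansion12_2; split; [left | lra].
- move=> e r_lt ge IH; have [s es] := greedy_head ge.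
  apply/expansion12_cons3; first by rewrite es.
  split; first by right.
  exists ((1 - r) / (1 - 2 * r)) => //; rewrite invf_div.
  have -> : 2 * (-1)%:~R + (1 - 2 * r) / (1 - r) = - (1 - r)^-1.
    by field; lra.
  split; last by field; lra.
    by rewrite mulf_neq0 ?invr_eq0; lra.
  by rewrite oppr_eq0 invr_eq0; lra.
- move=> e r_lt ge IH; have [s es] := greedy_head ge.
  apply/expansion12_cons3_opp; first by rewrite es.
  split; first by right.
  exists ((1 - r) / (2 * r - 1)) => //; rewrite invf_div.
  have -> : 2 * (-1)%:~R - (2 * r - 1) / (1 - r) = - (1 - r)^-1.
    by field; lra.
  split; last by field; lra.
    by rewrite mulf_neq0 ?invr_eq0; lra.
  by rewrite oppr_eq0 invr_eq0; lra.
- move=> e r_lt ge IH; have [s es] := greedy_head ge.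
  apply/expansion12_cons3; first by rewrite es.
  split; first by left.
  exists ((r - 1) / (3 - 2 * r)) => //; rewrite invf_div.
  have -> : 2 * 1%:~R + (3 - 2 * r) / (r - 1) = (r - 1)^-1.
    by field; lra.
  split; last by field; lra.
    by rewrite mulf_neq0 ?invr_eq0; lra.
  by rewrite invr_eq0; lra.
- move=> e r_lt ge IH; have [s es] := greedy_head ge.
  apply/expansion12_cons3_opp; first by rewrite es.
  split; first by left.
  exists ((r - 1) / (2 * r - 3)) => //; rewrite invf_div.
  have -> : 2 * 1%:~R - (2 * r - 3) / (r - 1) = (r - 1)^-1.
    by field; lra.
  split; last by field; lra.
    by rewrite mulf_neq0 ?invr_eq0; lra.
  by rewrite invr_eq0; lra.
- move=> e r_lt ge IH; have [s es] := greedy_head ge.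
  pose v : rat := (r - 1) / (2 * r - 3).
  have ev : expansion12 v [:: 1, -1 & map -%R e].
    apply/expansion12_cons3_opp; first by rewrite es.
    split; first by right.
    exists (r - 2) => //.
    have -> : 2 * (-1)%:~R - (r - 2)^-1 = - ((2 * r - 3) / (r - 2)).
      by field; lra.
    split; first lra.
      by rewrite oppr_eq0 mulf_neq0 ?invr_eq0; lra.
    by rewrite /v; field; apply/andP; split; lra.
  have -> : [:: 1, 1, -1, 1 & e] = [:: 1, 1 & map -%R [:: 1, -1 & map -%R e]].
    by rewrite /= -map_comp (eq_map (@opprK _)) map_id.
  apply/expansion12_cons3_opp => //; split; first by left.
  exists v => //; rewrite invf_div.
  have -> : 2 * 1%:~R - (2 * r - 3) / (r - 1) = (r - 1)^-1 by field; lra.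
  split; last by field; lra.
    by rewrite mulf_neq0 ?invr_eq0; lra.
  by rewrite invr_eq0; lra.
Qed.

Lemma expansion12_case (r : rat) (e : seq int) : expansion12 r e ->
  exists y, (y = 1 \/ y = -1) /\
    (e = [:: 1; y] \/
     exists2 s, s`_0 = 1 & e = [:: 1, y & s] \/ e = [:: 1, y & map -%R s]).
Proof.
case: e => [|x [|y s]] [[n n0 sz] u /= x1 _]; try by move: sz => /=; lia.
exists y; rewrite x1; split; first by apply: u; rewrite !inE eqxx orbT.
case: s sz u => [|z s] sz u; [by left | right].
have [->|->] : z = 1 \/ z = -1 by apply: u; rewrite !inE eqxx !orbT.
  by exists (1 :: s) => //; left.
exists (1 :: map -%R s) => //; right.
by rewrite /= -map_comp (eq_map (@opprK _)) map_id.
Qed.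

Lemma greedy_cons_pos_pos (t : rat) (e : seq int) : greedy t e ->
  greedy (1 + (2 * 1%:~R + t^-1)^-1) [:: 1, 1 & e].
Proof.
move=> gt; have t_gt0 := greedy_gt0 gt.
have -> : 1 + (2 * 1%:~R + t^-1)^-1 = (3 * t + 1) / (2 * t + 1).
  by field; apply/andP; split; lra.
apply: greedy_1_three_halves; first by rewrite ltr_pdivlMr ?ltr_pdivrMr; lra.
by congr (greedy _ _): gt; field; apply/andP; split; lra.
Qed.

Lemma greedy_cons_neg_pos (t : rat) (e : seq int) : 1 < t -> greedy t e ->
  greedy (1 + (2 * (-1)%:~R + t^-1)^-1) [:: 1, -1 & e].
Proof.
move=> t_gt1 gt; have t_gt0 := greedy_gt0 gt.
have -> : 1 + (2 * (-1)%:~R + t^-1)^-1 = (t - 1) / (2 * t - 1).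
  by field; apply/andP; split; lra.
apply: greedy_0_half; first by rewrite ltr_pdivlMr ?ltr_pdivrMr; lra.
by congr (greedy _ _): gt; field; apply/andP; split; lra.
Qed.

Lemma greedy_cons_neg_neg (t : rat) (e : seq int) : greedy t e ->
  greedy (1 + (2 * (-1)%:~R - t^-1)^-1) [:: 1, -1 & map -%R e].
Proof.
move=> gt; have t_gt0 := greedy_gt0 gt.
have -> : 1 + (2 * (-1)%:~R - t^-1)^-1 = (t + 1) / (2 * t + 1).
  by field; apply/andP; split; lra.
apply: greedy_half_1; first by rewrite ltr_pdivlMr ?ltr_pdivrMr; lra.
by congr (greedy _ _): gt; field; apply/andP; split; lra.
Qed.

Lemma greedy_cons_pos_neg (t : rat) (e : seq int) : 1 < t -> greedy t e ->
  greedy (1 + (2 * 1%:~R - t^-1)^-1) [:: 1, 1 & map -%R e].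
Proof.
move=> t_gt1 gt; have t_gt0 := greedy_gt0 gt.
have -> : 1 + (2 * 1%:~R - t^-1)^-1 = (3 * t - 1) / (2 * t - 1).
  by field; apply/andP; split; lra.
apply: greedy_three_halves_2; first by rewrite ltr_pdivlMr ?ltr_pdivrMr; lra.
by congr (greedy _ _): gt; field; apply/andP; split; lra.
Qed.

Lemma greedy_cons_pos_neg_pos (t w : rat) (e : seq int) : greedy w e ->
  t = 1 + (2 * (-1)%:~R - w^-1)^-1 ->
  greedy (1 + (2 * 1%:~R - t^-1)^-1) [:: 1, 1, -1, 1 & e].
Proof.
move=> gw ->; have w_gt0 := greedy_gt0 gw.
have -> : 1 + (2 * (-1)%:~R - w^-1)^-1 = (w + 1) / (2 * w + 1).
  by field; apply/andP; split; lra.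
have -> : 1 + (2 * 1%:~R - ((w + 1) / (2 * w + 1))^-1)^-1 = w + 2.
  by field; apply/andP; split; lra.
by apply: greedy_gt2; [lra | rewrite addrK].
Qed.

Lemma expansion12_greedy (r : rat) (e : seq int) :
  expansion12 r e -> no_three_consecutive_sign_changes e -> greedy r e.
Proof.
have [n] := ubnP (size e); elim: n r e => // n IHn r e lt_en er.
have [y [yu [e2|[s s0 [es|es]]]]] := expansion12_case er; subst e.
- by move/expansion12_2: er => [[] -> ->] _;
    [apply: greedy_three_halves | apply: greedy_half]; lra.
- move/expansion12_cons3: er => /(_ s0)[_ [t ets [_ _ ->]]].
  case/no_three_cons=> nt0 /no_three_cons[_ nt].
  have gs : greedy t s by apply: IHn => //; move: lt_en => /=; lia.
  case: yu => yE; subst y; first exact: greedy_cons_pos_pos.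
  apply: greedy_cons_neg_pos => //; have [s' ss'] := greedy_head gs.
  by move: nt0; rewrite ss'; case: ifP.
- move/expansion12_cons3_opp: er => /(_ s0)[_ [t ets [_ u0 ->]]].
  case/no_three_cons=> _ /no_three_cons[nt1 /no_three_opp nt].
  have gs : greedy t s.
    by apply: IHn => //; move: lt_en; rewrite /= size_map; lia.
  case: yu => yE; subst y; last exact: greedy_cons_neg_neg.
  have [t_gt1|t_le1] := ltrP 1 t; first exact: greedy_cons_pos_neg.
  have [z [zu [s2|[q q0 sq]]]] := expansion12_case ets.
    move: ets; rewrite s2 => /expansion12_2[_ tE]; case: zu => zE.
      have : 1 < t by rewrite tE zE; lra.
      by rewrite ltNge t_le1.
    have t_half : t = 2^-1 by rewrite tE zE; lra.
    by case/eqP: u0; rewrite t_half invrK subrr.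
  have zE : z = -1.
    case: zu => // zE; have [s'] := greedy_head gs.
    by rewrite ltNge t_le1; case: sq => ->; rewrite zE.
  subst z; case: sq => sq; subst s.
    by case: q q0 nt1 {s0 ets nt gs lt_en} => //= x q ->.
  move/expansion12_cons3_opp: ets => /(_ q0)[_ [w eqw [_ _ tE]]].
  rewrite /= -map_comp (eq_map (@opprK _)) map_id.
  apply: greedy_cons_pos_neg_pos tE; apply: IHn => //.
    by move: lt_en; rewrite /= !size_map; lia.
  by case/no_three_cons: nt => _ /no_three_cons[_ /no_three_opp].
Qed.

Lemma expansion12_odd_even (r : rat) (e : seq int) : expansion12 r e ->
  exists p q : int, [/\ q != 0, r = p%:~R / q%:~R, odd `|p| & ~~ odd `|q|].
Proof.
have [n] := ubnP (size e); elim: n r e => // n IHn r e lt_en er.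
have step (s : seq int) t (y c : int) : (size s < n)%N -> expansion12 t s ->
  c = 1 \/ c = -1 -> 2 * y%:~R + c%:~R * t^-1 != 0 ->
  exists p q : int,
    [/\ q != 0, 1 + (2 * y%:~R + c%:~R * t^-1)^-1 = p%:~R / q%:~R,
        odd `|p| & ~~ odd `|q|].
  move=> lt_s ets cu u0; have [p [q [q0 tE op oq]]] := IHn t s lt_s ets.
  have p0 : (p%:~R : rat) != 0 by rewrite intr_eq0; lia.
  pose d : int := 2 * y * p + c * q.
  have E : 2 * y%:~R + c%:~R * t^-1 = d%:~R / p%:~R.
    by rewrite tE rmorphD !rmorphM; field; rewrite p0 intr_eq0.
  have dR : (d%:~R : rat) != 0 by apply: contraNneq u0 => d0; rewrite E d0 mul0r.
  have [od d0] : ~~ odd `|d| /\ d != 0.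
    by rewrite intr_eq0 in dR; split; rewrite // /d; case: cu => ->; lia.
  exists (d + p), d; split=> //; last lia.
  by rewrite E invf_div intrD mulrDl divff.
have [y [yu [e2|[s s0 [es|es]]]]] := expansion12_case er; subst e.
- move/expansion12_2: er => [_ ->]; exists (2 * y + 1), (2 * y).
  by case: yu => ->.
- move/expansion12_cons3: er => /(_ s0)[_ [t ets [_ u0 ->]]].
  rewrite -[t^-1]mul1r; apply: (step s _ _ 1) => //.
  + by move: lt_en => /=; lia.
  + by left.
  + by rewrite mul1r.
- move/expansion12_cons3_opp: er => /(_ s0)[_ [t ets [_ u0 ->]]].
  rewrite -mulN1r; apply: (step s _ _ (-1)) => //.
  + by move: lt_en; rewrite /= size_map; lia.
  + by right.
  + by rewrite mulN1r.
Qed.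

Theorem theorem2p21 (alpha beta : nat)
    (alpha_gt0 : (0 < alpha)%N) (beta_gt0 : (0 < beta)%N)
    (alpha_beta_coprime : coprime alpha beta) :
  let r : rat := alpha%:R / beta%:R in
  [/\ (exists e : seq int, expansion12 r e) <-> (2 %| beta)%N,
      (2 %| beta)%N ->
        exists! e : seq int,
          expansion12 r e /\ no_three_consecutive_sign_changes (terms12 e)
    & forall e : seq int,
        expansion12 r e -> no_three_consecutive_sign_changes (terms12 e) ->
        ((beta < alpha)%N <-> e`_0 = 1 /\ e`_1 = 1)].
Proof.
move=> r.
have beta_R : (0 : rat) < beta%:R by rewrite ltr0n.
have greedy_r : (2 %| beta)%N -> exists e, greedy r e.
  move=> beta2; apply: greedy_exists => //; last by rewrite -dvdn2.
  have := coprime_dvdr beta2 alpha_beta_coprime.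
  by rewrite coprime_sym prime_coprime // dvdn2 negbK.
have odd_even e : expansion12 r e -> (2 %| beta)%N.
  case/expansion12_odd_even=> p [q [q0 rE op oq]].
  have : alpha%:Z * q = p * beta%:Z.
    apply/eqP; rewrite -(eqr_int rat) !intrM -eqr_div ?intr_eq0 //; last lia.
    by rewrite -rE.
  move/(congr1 (odd \o absz)).
  by rewrite /= !abszM !oddM op (negbTE oq) dvdn2 andbF /= => <-.
split=> [|/greedy_r[e ge]|e er /no_three_terms12 nt].
- split=> [[e /odd_even]|/greedy_r[e ge]] //.
  by exists e; apply: greedy_expansion12.
- exists e; split.
    by split; [apply: greedy_expansion12 | apply/no_three_terms12/(greedy_no_three ge)].
  by move=> e' [er /no_three_terms12 nt]; apply/(greedy_unique ge)/expansion12_greedy.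
- have [s ->] := greedy_head (expansion12_greedy er nt).
  rewrite -(ltr_nat rat) /= {1}/r ltr_pdivlMr // mul1r.
  by case: ifP => // _; split=> // -[].
Qed.
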